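(* Let $A_1,\dots,A_n$ ($n\ge 2$) be agents in a distributed network whose only initial entanglement between agents consists of EPR pairs shared by pairs of agents, and let $G$ be their EPR graph. If the $n$-partite maximally entangled state $(|00\cdots 0\rangle+|11\cdots 1\rangle)/\sqrt{2}$ can be prepared amongst the $n$ agents (one qubit held by each agent) by local operations and classical communication, then $G$ is connected.
   Context: The EPR graph of $n$ agents $A_1,\dots,A_n$ is the undirected graph $G=(V,E)$ with $V=\{A_1,\dots,A_n\}$ and $\{A_i,A_j\}\in E$ ($i\ne j$) if and only if $A_i$ and $A_j$ share an EPR pair, i.e. each holds one qubit of a two-qubit system in the state $(|00\rangle+|11\rangle)/\sqrt{2}$. The initial joint state is the tensor product over the edges of $G$ of these EPR pairs, together with local ancilla qubits in state $|0\rangle$. Local operations and classical communication (LOCC): each agent may adjoin ancillas, apply unitaries and perform measurements on the qubits it holds, conditioned on earlier outcomes and on received classical bits, and agents may exchange classical bits. There is no quantum communication after the EPR pairs have been distributed. The state is ''prepared'' if, for every sequence of measurement outcomes, at the end $n$ designated qubits, one per agent, are in the stated state (up to global phase, in tensor product with the remaining qubits). *)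

(* Defs.v *)
From HB Require Import structures.
From mathcomp Require Import all_boot all_order all_algebra.
From mathcomp Require Import reals.
From mathcomp.real_closed Require Import complex.

Set Implicit Arguments.
Unset Strict Implicit.
Unset Printing Implicit Defensive.

Import Order.TTheory GRing.Theory Num.Theory.
Local Open Scope ring_scope.
Local Open Scope sesquilinear_scope.

Section States.
Variable C : numClosedFieldType.

(* A vector of the Hilbert space of the qubits Q, given by its amplitudes in
   the computational basis: psi x is the coefficient of |x>. *)
Definition state (Q : finType) := {ffun {ffun Q -> bool} -> C}.

Definition ket (Q : finType) (b : {ffun Q -> bool}) : state Q :=
  [ffun x => (x == b)%:R].

Definition norm2 (Q : finType) (psi : state Q) : C := \sum_x `|psi x| ^+ 2.

Definition normalize (Q : finType) (psi : state Q) : state Q :=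
  [ffun x => psi x / sqrtC (norm2 psi)].

(* (|0...0> + |1...1>) / sqrt 2 on the qubits T *)
Definition max_entangled (T : finType) : state T :=
  [ffun x => (ket [ffun=> false] x + ket [ffun=> true] x) / sqrtC 2].

End States.

Definition restrict (Q : finType) (P : pred Q) (x : {ffun Q -> bool}) :
  {ffun {q | P q} -> bool} := [ffun q => x (val q)].

Definition overwrite (Q : finType) (P : pred Q) (x : {ffun Q -> bool})
    (y : {ffun {q | P q} -> bool}) : {ffun Q -> bool} :=
  [ffun q => if insub q is Some q' then y q' else x q].

Section LOCC.
Variables (C : numClosedFieldType) (n : nat).

(* The qubits present at a given time form a finite type Q, and
   own : Q -> 'I_n tells which agent holds each of them. *)
Section Register.
Variables (Q : finType) (own : Q -> 'I_n).

Definition held (i : 'I_n) : finType := {q : Q | own q == i}.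

(* Operators on the Hilbert space of the qubits held by agent i, as matrices
   in the computational basis enumerated by enum_rank. *)
Definition local_op (i : 'I_n) := 'M[C]_#|{ffun held i -> bool}|.

(* (K (x) Id) psi, with Id acting on the qubits that i does not hold *)
Definition apply_local (i : 'I_n) (K : local_op i) (psi : state C Q) :
    state C Q :=
  [ffun x => \sum_(y : {ffun held i -> bool})
     K (enum_rank (restrict _ x)) (enum_rank y) * psi (overwrite x y)].

Definition adjoin_own (i : 'I_n) (q : option Q) : 'I_n :=
  if q is Some q' then own q' else i.

(* psi (x) |0>, the new qubit being None *)
Definition adjoin_state (psi : state C Q) : state C (option Q) :=
  [ffun x : {ffun option Q -> bool} => psi [ffun q => x (Some q)] * (x None == false)%:R].

(* A measurement by agent i with outcomes 'I_m, given by its measurement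
   operators. *)
Definition is_measurement (i : 'I_n) (m : nat) (M : 'I_m -> local_op i) :=
  \sum_k (M k)^t* *m M k = 1%:M.

(* Qubit out i is held by agent i. Up to global phase, these n qubits are in the
   state (|0...0> + |1...1>) / sqrt 2, in tensor product with some state phi
   of all the other qubits. *)
Definition prepared (out : forall i, held i) (psi : state C Q) : Prop :=
  let designated q := q \in codom (fun i => val (out i)) in
  exists (c : C) (phi : state C {q | ~~ designated q}),
    [/\ `|c| = 1, norm2 phi = 1 &
     forall x, psi x = c * (max_entangled C 'I_n [ffun i => x (val (out i))]
                            * phi (restrict (fun q => ~~ designated q) x))].

End Register.

(* LOCC protocols as finite trees. Each operation is performed by one agent on
   the qubits it holds. The subtree that follows a measurement depends on the
   outcome, so that every later choice may depend on all earlier outcomes: this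
   is what unlimited classical communication between the agents allows. The
   leaves designate one qubit of each agent. *)
Inductive protocol (Q : finType) (own : Q -> 'I_n) : Type :=
| Finish (out : forall i, held own i)
| Adjoin (i : 'I_n) (p : protocol (adjoin_own own i))
| Apply (i : 'I_n) (U : local_op own i) (unitaryU : U \is unitarymx)
    (p : protocol own)
| Measure (i : 'I_n) (m : nat) (M : 'I_m -> local_op own i)
    (measM : is_measurement M) (p : 'I_m -> protocol own).

(* Run from the state psi, the protocol prepares the n-partite maximally
   entangled state for every sequence of measurement outcomes, where outcome
   k of a measurement occurs with probability norm2 (apply_local (M k) psi). *)
Fixpoint prepares (Q : finType) (own : Q -> 'I_n) (p : protocol own) :
    state C Q -> Prop :=
  match p with
  | Finish out => fun psi => prepared out psi
  | Adjoin _ p' => fun psi => prepares p' (adjoin_state psi)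
  | Apply _ U _ p' => fun psi => prepares p' (apply_local U psi)
  | Measure _ _ M _ p' => fun psi => forall k,
      let psi' := apply_local (M k) psi in
      norm2 psi' != 0 -> prepares (p' k) (normalize psi')
  end.

End LOCC.

Section EPR.
Variables (n : nat) (e : rel 'I_n).

(* the edges {i, j} of the graph, represented by the pairs with i < j *)
Definition edge : finType := {d : 'I_n * 'I_n | e d.1 d.2 && (d.1 < d.2)%N}.

(* Each edge carries two qubits, labelled false at its lower endpoint and true
   at its upper endpoint. *)
Definition epr_qubit : finType := (edge * bool)%type.

Definition epr_own (q : epr_qubit) : 'I_n :=
  if q.2 then (val q.1).2 else (val q.1).1.

(* the tensor product over the edges of the states (|00> + |11>) / sqrt 2 *)
Definition epr_state (C : numClosedFieldType) : state C epr_qubit :=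
  [ffun x : {ffun epr_qubit -> bool} =>
     \prod_(d : edge) max_entangled C bool [ffun b => x (d, b)]].

End EPR.

(* Main.v *)
Require Import Defs.
From HB Require Import structures.
From mathcomp Require Import all_boot all_order all_algebra.
From mathcomp Require Import reals.
From mathcomp.real_closed Require Import complex.

(** Let S be the connected component of an agent.  No EPR pair crosses the cut
    between S and its complement, so the initial state is a product state across
    this cut.  A local operation acts on one side of the cut only, so the state
    remains a nonzero product state along some sequence of outcomes.  But the
    state (|0...0> + |1...1>) / sqrt 2, even in tensor product with another
    state, is not a product state across a cut with agents on both sides. *)

Set Implicit Arguments.
Unset Strict Implicit.
Unset Printing Implicit Defensive.

Import Order.TTheory GRing.Theory Num.Theory.
Local Open Scope ring_scope.

(** * Replacing the values of a subset of the qubits *)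

Section Overwrite.
Variables (Q : finType) (P : pred Q).
Implicit Types (x : {ffun Q -> bool}) (y z : {ffun {q | P q} -> bool}).

Lemma overwrite_in x y q (Pq : P q) : overwrite x y q = y (exist _ q Pq).
Proof.
rewrite ffunE; case: insubP => [u _ uq|]; last by rewrite Pq.
by congr (y _); apply: val_inj.
Qed.

Lemma overwrite_out x y q : ~~ P q -> overwrite x y q = x q.
Proof. by move=> NPq; rewrite ffunE insubN. Qed.

Lemma restrict_overwrite x y : Defs.restrict P (overwrite x y) = y.
Proof. by apply/ffunP => -[q Pq]; rewrite ffunE (overwrite_in _ _ Pq). Qed.

Lemma overwrite_restrict x : overwrite x (Defs.restrict P x) = x.
Proof.
apply/ffunP => q; have [Pq|NPq] := boolP (P q); last by rewrite overwrite_out.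
by rewrite (overwrite_in _ _ Pq) ffunE.
Qed.

Lemma overwrite_overwrite x y z : overwrite (overwrite x y) z = overwrite x z.
Proof.
apply/ffunP => q; have [Pq|NPq] := boolP (P q); last by rewrite !overwrite_out.
by rewrite !(overwrite_in _ _ Pq).
Qed.

End Overwrite.

(** * Nonzero norms and amplitudes *)

Section Norm.
Variables (C : numClosedFieldType) (Q : finType).
Implicit Type psi : state C Q.

Lemma norm2_eq0 psi : norm2 psi = 0 <-> forall x, psi x = 0.
Proof.
split=> [/eqP | psi0]; last by apply: big1 => x _; rewrite psi0 normr0 expr0n.
rewrite psumr_eq0 => [/allP psi0 x|x _]; last exact: exprn_ge0.
by apply/eqP; have := psi0 x (mem_index_enum x); rewrite sqrf_eq0 normr_eq0.
Qed.

Lemma norm2_neq0 psi : norm2 psi != 0 <-> exists x, psi x != 0.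
Proof.
split=> [|[x]]; last by apply: contraNneq => /norm2_eq0->.
move=> npsi; apply/existsP; apply: contraNT npsi => /existsPn psi0.
by apply/eqP/norm2_eq0 => x; apply/eqP; have := psi0 x; rewrite negbK.
Qed.

Lemma norm2_normalize psi : norm2 psi != 0 -> norm2 (normalize psi) != 0.
Proof.
move=> npsi; have /norm2_neq0[x psix] := npsi; apply/norm2_neq0; exists x.
by rewrite ffunE mulf_neq0 ?invr_eq0 ?sqrtC_eq0.
Qed.

End Norm.

(** The element [t] makes [T] nonempty, so the two constant assignments differ and exactly one ket
    contributes. *)
Lemma max_entangled_const (C : numClosedFieldType) (T : finType) (b : bool)
  (t : T) : max_entangled C T [ffun=> b] = (sqrtC 2)^-1.
Proof.
have neq_const c : ([ffun=> c] == [ffun=> ~~ c] :> {ffun T -> bool}) = false.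
  by apply/eqP => /ffunP/(_ t); rewrite !ffunE; case: c.
by case: b; rewrite !ffunE eqxx ?(neq_const true) ?(neq_const false)
  ?add0r ?addr0 mul1r.
Qed.

Lemma max_entangled_nonconst (C : numClosedFieldType) (T : finType)
  (x : {ffun T -> bool}) (s t : T) : x s != x t -> max_entangled C T x = 0.
Proof.
move=> xst; have neq_const c : (x == [ffun=> c]) = false.
  by apply: contraNF xst => /eqP->; rewrite !ffunE.
by rewrite !ffunE !neq_const addr0 mul0r.
Qed.

Lemma sqrtC2_neq0 (C : numClosedFieldType) : (sqrtC 2)^-1 != 0 :> C.
Proof. by rewrite invr_eq0 sqrtC_eq0 pnatr_eq0. Qed.

(** * Recombining basis states across a cut *)

Section Mix.
Variables (n : nat) (Q : finType) (own : Q -> 'I_n).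

Definition mix (S : pred 'I_n) (x y : {ffun Q -> bool}) : {ffun Q -> bool} :=
  [ffun q => if S (own q) then x q else y q].

Lemma mix_predC S x y : mix (predC S) x y = mix S y x.
Proof. by apply/ffunP => q; rewrite !ffunE /=; case: (S _). Qed.

Variables (S : pred 'I_n) (i : 'I_n) (Si : S i).
Implicit Types a b : {ffun held own i -> bool}.

Lemma restrict_mix x y :
  Defs.restrict (fun q => own q == i) (mix S x y) = Defs.restrict _ x.
Proof. by apply/ffunP => -[q qi]; rewrite !ffunE /= (eqP qi) Si. Qed.

(** As [i] lies in [S], its qubits come from the first argument and [b] is discarded. *)
Lemma mix_overwrite x y a b :
  mix S (overwrite x a) (overwrite y b) = overwrite (mix S x y) a.
Proof.
apply/ffunP => q; rewrite ffunE; have [qi|nqi] := boolP (own q == i).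
  by rewrite !(@overwrite_in _ (fun r => own r == i) _ _ _ qi) (eqP qi) Si.
by rewrite !overwrite_out // ffunE.
Qed.

End Mix.

(** * Product states under local operations *)

Section ProductState.
Variables (C : numClosedFieldType) (n : nat).

(* The amplitudes form a matrix with rows indexed by the basis states of the
   qubits held in S and columns by those of the other qubits: the state is a
   product across the cut iff the 2x2 minors of this matrix vanish. *)
Definition product_across (S : pred 'I_n) (Q : finType) (own : Q -> 'I_n)
    (psi : state C Q) :=
  forall x y, psi x * psi y = psi (mix own S x y) * psi (mix own S y x).

Section Register.
Variables (Q : finType) (own : Q -> 'I_n).
Implicit Types (S : pred 'I_n) (psi : state C Q).

Lemma product_across_predC S psi :
  product_across S own psi -> product_across (predC S) own psi.
Proof. by move=> prod_psi x y; rewrite !mix_predC mulrC -prod_psi mulrC. Qed.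

Lemma product_across_predCK S psi :
  product_across (predC S) own psi -> product_across S own psi.
Proof.
by move=> prod_psi x y; rewrite -!(mix_predC _ S) mulrC -prod_psi mulrC.
Qed.

Lemma product_across_normalize S psi :
  product_across S own psi -> product_across S own (normalize psi).
Proof. by move=> prod_psi x y; rewrite !ffunE !mulf_div prod_psi. Qed.

Lemma product_across_adjoin S psi i : product_across S own psi ->
  product_across S (adjoin_own own i) (adjoin_state psi).
Proof.
move=> prod_psi x y; rewrite !ffunE mulrACA prod_psi [RHS]mulrACA.
congr (psi _ * psi _ * _); first by apply/ffunP => q; rewrite !ffunE.
  by apply/ffunP => q; rewrite !ffunE.
by rewrite /=; case: (S i); rewrite // mulrC.
Qed.

Lemma norm2_adjoin psi : norm2 psi != 0 -> norm2 (adjoin_state psi) != 0.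
Proof.
move=> /norm2_neq0[x psix]; apply/norm2_neq0.
exists [ffun q => if q is Some q' then x q' else false].
rewrite !ffunE eqxx mulr1.
suff -> : [ffun q => [ffun q => if q is Some q' then x q' else false] (Some q)]
  = x by [].
by apply/ffunP => q; rewrite !ffunE.
Qed.

Variable i : 'I_n.
Implicit Type K : local_op C own i.

(** For [i] in [S], both sides expand to sums over local contents [a], [b] with the same
    coefficients, so the identity for [psi] applies term by term. [K] is arbitrary, to cover
    unitaries and measurement operators alike. *)
Lemma product_across_apply S psi K : product_across S own psi ->
  product_across S own (apply_local K psi).
Proof.
wlog Si : S / S i => [in_case prod_psi|prod_psi x y].
  have [Si|NSi] := boolP (S i); first exact: in_case.
  by apply/product_across_predCK/in_case => //; apply: product_across_predC.
rewrite !ffunE !(restrict_mix own Si) !big_distrlr /=.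
apply: eq_bigr => a _; apply: eq_bigr => b _.
by rewrite mulrACA prod_psi !(mix_overwrite Si) [RHS]mulrACA.
Qed.

(** With the qubits of the other agents fixed by [x], local operators act on this vector by matrix
    product. *)
Definition local_amplitudes psi x : 'cV[C]_#|{ffun held own i -> bool}| :=
  \col_k psi (overwrite x (enum_val k)).

Lemma local_amplitudes_apply psi K x :
  local_amplitudes (apply_local K psi) x = K *m local_amplitudes psi x.
Proof.
apply/colP => k; rewrite !mxE ffunE restrict_overwrite enum_valK.
rewrite (reindex_onto enum_rank enum_val) => [|l _]; last exact: enum_valK.
apply: eq_big => [y|y _]; first by rewrite enum_rankK eqxx.
by rewrite !mxE enum_rankK overwrite_overwrite.
Qed.

Lemma local_amplitudes_eq0 psi :
  (forall x, local_amplitudes psi x = 0) <-> norm2 psi = 0.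
Proof.
rewrite norm2_eq0; split=> psi0 x; last by apply/colP => k; rewrite !mxE.
have /colP/(_ (enum_rank (Defs.restrict _ x))) := psi0 x.
by rewrite !mxE enum_rankK overwrite_restrict.
Qed.

(** If every outcome had norm zero, each [M k] would kill all local amplitude vectors; so would the
    sum of the [(M k)^t* *m M k], which is the identity. *)
Lemma measurement_outcome psi m (M : 'I_m -> local_op C own i) :
  is_measurement M -> norm2 psi != 0 ->
  exists k, norm2 (apply_local (M k) psi) != 0.
Proof.
move=> measM npsi; apply/existsP; apply: contraNT npsi => /existsPn psi0.
apply/eqP/local_amplitudes_eq0 => x.
rewrite -[LHS]mul1mx -measM mulmx_suml big1 // => k _.
rewrite -mulmxA -local_amplitudes_apply.
have /local_amplitudes_eq0-> : norm2 (apply_local (M k) psi) = 0.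
  by apply/eqP; have := psi0 k; rewrite negbK.
by rewrite mulmx0.
Qed.

Lemma norm2_unitary psi K :
  K \is unitarymx -> norm2 psi != 0 -> norm2 (apply_local K psi) != 0.
Proof.
move=> /unitarymxP unitK npsi.
(* A unitary is a measurement with a single outcome. *)
have measK : is_measurement (fun _ : 'I_1 => K).
  by rewrite /is_measurement big_ord1; apply: mulmx1C.
by have [_] := measurement_outcome measK npsi.
Qed.

Lemma prepared_product_across S psi (out : forall k, held own k) :
  prepared out psi -> product_across S own psi -> forall j k, S j = S k.
Proof.
move=> [c [phi [normc normphi psiE]]] prod_psi j k.
apply/eqP/negPn/negP => Sjk.
have /norm2_neq0[z phiz] : norm2 phi != 0 by rewrite normphi oner_neq0.
have c_neq0 : c != 0 by rewrite -normr_eq0 normc oner_neq0.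
(* All designated qubits read [b]; the others are set to [z], where [phi] does not vanish. *)
pose w (b : bool) := overwrite [ffun=> b] z.
have w_out b l : w b (val (out l)) = b.
  rewrite overwrite_out ?ffunE // negbK.
  exact: (codom_f (fun i => val (out i))).
have psiw b : psi (w b) != 0.
  rewrite psiE restrict_overwrite !mulf_neq0 //.
  suff -> : [ffun l => w b (val (out l))] = [ffun=> b].
    by rewrite (max_entangled_const _ _ j) sqrtC2_neq0.
  by apply/ffunP => l; rewrite ffunE w_out ffunE.
have mix_out l : mix own S (w true) (w false) (val (out l)) = S l.
  by rewrite ffunE !w_out (eqP (valP (out l))); case: (S l).
(* In the mixed basis state the designated qubit of agent [l] reads [S l]. As [S j] and [S k]
   differ, its amplitude is zero. *)
have /eqP[] := mulf_neq0 (psiw true) (psiw false).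
rewrite prod_psi psiE (@max_entangled_nonconst _ _ _ j k).
  by rewrite mul0r mulr0 mul0r.
by rewrite ffunE mix_out ffunE mix_out.
Qed.

End Register.

Lemma prepares_product_across (S : pred 'I_n) (Q : finType) (own : Q -> 'I_n)
    (p : protocol C own) (psi : state C Q) :
  prepares p psi -> product_across S own psi -> norm2 psi != 0 ->
  forall j k, S j = S k.
Proof.
elim: p psi => {Q own} [Q own out|Q own i p IHp|Q own i U unitU p IHp
  |Q own i m M measM p IHp] psi /= prep prod_psi npsi.
- exact: prepared_product_across prep prod_psi.
- by apply: IHp prep _ _; [apply: product_across_adjoin | apply: norm2_adjoin].
- by apply: IHp prep _ _; [apply: product_across_apply | apply: norm2_unitary].
(* [prepares] constrains only outcomes of nonzero probability; following one of them suffices. *)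
have [k nk] := measurement_outcome measM npsi.
apply: IHp (prep k nk) _ (norm2_normalize nk).
exact/product_across_normalize/product_across_apply.
Qed.

End ProductState.

(** * The initial state and the connected component *)

Lemma product_across_epr (C : numClosedFieldType) (n : nat) (e : rel 'I_n)
    (S : pred 'I_n) : (forall j k, e j k -> S j = S k) ->
  product_across S (@epr_own n e) (epr_state e C).
Proof.
move=> S_closed x y; rewrite !ffunE -!big_split; apply: eq_bigr => d _ /=.
(* Both ends of an edge lie on the same side, so mixing takes the two qubits of a pair from the same
   argument. *)
have mixE u v : [ffun b => mix (@epr_own n e) S u v (d, b)] =
    if S (val d).1 then [ffun b => u (d, b)] else [ffun b => v (d, b)].
  have /andP[/S_closed Sd _] := valP d.
  by apply/ffunP => b; rewrite !ffunE /epr_own /=; case: b; rewrite -?Sd;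
    case: (S _); rewrite ffunE.
by rewrite !mixE; case: (S _); rewrite // mulrC.
Qed.

Lemma norm2_epr (C : numClosedFieldType) (n : nat) (e : rel 'I_n) :
  norm2 (epr_state e C) != 0.
Proof.
apply/norm2_neq0; exists [ffun=> false]; rewrite ffunE; apply/prodf_neq0 => d _.
suff -> : [ffun b => [ffun=> false] (d, b)] = [ffun=> false]
  :> {ffun bool -> bool}.
  by rewrite (max_entangled_const _ _ true) sqrtC2_neq0.
by apply/ffunP => b; rewrite !ffunE.
Qed.

Theorem theorem3p2 (R : realType) (n : nat) (n_ge2 : (2 <= n)%N)
    (e : rel 'I_n) (e_sym : symmetric e) (e_irr : irreflexive e) :
  (exists p : protocol (complex R) (@epr_own n e),
     prepares p (epr_state e (complex R))) ->
  forall i j : 'I_n, connect e i j.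
Proof.
move=> [p prep] i j.
have S_closed k l : e k l -> connect e i k = connect e i l.
  by move=> /(same_connect1r (sym_connect_sym e_sym))->.
(* The cut [connect e i] takes equal values at [i] and [j], which reduces the goal to
   [connect e i i]. *)
rewrite -(prepares_product_across prep (product_across_epr _ S_closed)
  (norm2_epr _ _) i j).
exact: connect0.
Qed.
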